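(* Let $H$ be a separable complex Hilbert space, let $m,n$ be positive integers and let $A\in\mathcal{B}(H)^+$ with $0\notin\sigma_p(A)$. Then every $(A;(m,n))$-isosymmetric operator $T\in\mathcal{B}(H)$ has the single valued extension property.
   Context: $\mathcal{B}(H)$ is the algebra of bounded linear operators on $H$, $\mathcal{B}(H)^+$ the set of positive (semi-definite) operators, and $\sigma_p(A)$ the point spectrum of $A$. For $A,T\in\mathcal{B}(H)$ put $$\mathcal{S}^n_A(T)=\sum_{k=0}^n(-1)^{n-k}\binom nk T^{*k}AT^{n-k},\qquad \Omega_A^{m,n}(T)=\sum_{j=0}^m(-1)^{m-j}\binom mj T^{*j}\mathcal{S}^n_A(T)T^j.$$ $T$ is $(A;(m,n))$-isosymmetric if $\Omega_A^{m,n}(T)=0$. $T$ has the single valued extension property at $\lambda_0\in\mathbb{C}$ if for every open set $D\subset\mathbb{C}$ containing $\lambda_0$, the only analytic function $f:D\to H$ satisfying $(T-\lambda)f(\lambda)=0$ for all $\lambda\in D$ is $f\equiv0$; $T$ has the single valued extension property if it has it at every $\lambda_0\in\mathbb{C}$. *)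

(* Defs.v *)
From HB Require Import structures.
From mathcomp Require Import all_boot all_order all_algebra.
From mathcomp Require Import all_classical all_reals all_analysis.
From mathcomp Require Import complex.

Set Implicit Arguments.
Unset Strict Implicit.
Unset Printing Implicit Defensive.

Import Order.TTheory GRing.Theory Num.Theory.
Import numFieldNormedType.Exports.

Local Open Scope classical_set_scope.
Local Open Scope ring_scope.

(* The inner product is linear in its first argument and conjugate-linear in
   the second one. *)
HB.mixin Record CompleteNormedModule_isHilbert (R : realType) H
    of CompleteNormedModule R[i] H := {
  inner : {dot H for Num.conj} ;
  inner_norm : forall x : H, inner x x = `|x| ^+ 2
}.

#[short(type="hilbertType")]
HB.structure Definition Hilbert (R : realType) :=
  {H of CompleteNormedModule R[i] H & CompleteNormedModule_isHilbert R H}.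

Definition separable (T : topologicalType) :=
  exists2 D : set T, countable D & dense D.

Section Operators.
Variables (R : realType) (H : hilbertType R).
Implicit Types A T : H -> H.

Definition bounded_op T := exists M : R[i], forall x, `|T x| <= M * `|x|.

(* For a bounded linear T, the set below is a singleton: it is nonempty by the
   Riesz representation theorem, so the default value 0 is not used. *)
Definition adjoint T : H -> H := fun y =>
  xget 0 [set z | forall x, inner (T x) y = inner x z].

(* Over the complex field, this condition implies that A is self-adjoint. The
   order of R[i] is partial: 0 <= z means that z is real and nonnegative. *)
Definition positive_op A := forall x, 0 <= inner (A x) x.

Definition point_spectrum A : set R[i] :=
  [set lambda | exists2 x, x != 0 & A x = lambda *: x].

Definition symm_op A T (n : nat) : H -> H := fun x =>
  \sum_(k < n.+1) ((-1) ^+ (n - k) * 'C(n, k)%:R) *: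
    iter k (adjoint T) (A (iter (n - k) T x)).

Definition isosymm_op A T (m n : nat) : H -> H := fun x =>
  \sum_(j < m.+1) ((-1) ^+ (m - j) * 'C(m, j)%:R) *:
    iter j (adjoint T) (symm_op A T n (iter j T x)).

Definition isosymmetric A (m n : nat) T := forall x, isosymm_op A T m n x = 0.

(* R[i]^o is R[i] as a normed space over itself, so that derivable refers to a
   limit of difference quotients with complex increments. The function f is
   total, but its values outside of the open set D are irrelevant. *)
Definition analytic_on (D : set R[i]^o) (f : R[i]^o -> H) :=
  forall lambda, D lambda -> derivable f lambda 1.

Definition svep_at T (lambda0 : R[i]) :=
  forall D : set R[i]^o, open D -> D lambda0 ->
  forall f : R[i]^o -> H, analytic_on D f ->
    (forall lambda, D lambda -> T (f lambda) - lambda *: f lambda = 0) ->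
  forall lambda, D lambda -> f lambda = 0.

Definition svep T := forall lambda0, svep_at T lambda0.

End Operators.

(* Main.v *)
Require Import Defs.
From mathcomp Require Import all_boot all_order all_algebra.
From mathcomp Require Import all_classical all_reals all_analysis.
From mathcomp Require Import complex.
From mathcomp Require Import ring.

Set Implicit Arguments.
Unset Strict Implicit.
Unset Printing Implicit Defensive.

Import Order.TTheory GRing.Theory Num.Theory.
Import numFieldNormedType.Exports.

Local Open Scope classical_set_scope.
Local Open Scope ring_scope.

(** Let [T x = a *: x] and [T y = b *: y]. Moving the adjoints of the
    isosymmetry relation to the other side of the inner product turns every
    power of [T] into a scalar, and the two binomial sums collapse:

      [0 = (a * b^* - 1) ^+ m * (b^* - a) ^+ n * inner (A x) y]

    ([inner_isosymm_op]). With [x = y] this gives [inner (A x) x = 0] as soon as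
    [a] is neither real nor of modulus 1; a positive operator then kills [x]
    ([positive_op_null]), and [A] is injective, so [x = 0]. Hence all eigenvalues
    of [T] lie on the real line or on the unit circle ([eigenvector_eq0]).

    A local solution [f] of [(T - lambda) f(lambda) = 0] is a family of
    eigenvectors, so it vanishes off these two curves. They have empty interior
    ([nonreal_nonunit_near]), and [f] is continuous because it is analytic:
    therefore [f] vanishes on its whole domain.

    The relation that defines the adjoint holds only if the functional
    [x |-> inner (T x) y] is represented by a vector. This is the Riesz theorem,
    proved here by minimising [|x|^2 - 2 Re (f x)] over the complete space [H]
    ([riesz_representation]). *)

(** * Small bounds and infima for a partial order *)

(** Were [a] positive, the value [e = a / ((k + 1) * (a + 1))] would contradict
    the hypothesis; a minimum of the bounds [1] and [a / (k + 1)] is avoided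
    because the order is only partial. *)
Lemma eq0_of_le_small (K : numFieldType) (a k : K) :
  0 <= a -> 0 <= k -> (forall e, 0 < e -> e <= 1 -> a <= k * e) -> a = 0.
Proof.
move=> a_ge0 k_ge0 small; apply/eqP; apply: contraT => a_neq0.
have a_gt0 : 0 < a by rewrite lt_def a_neq0.
have d_gt0 : 0 < (k + 1) * (a + 1) by rewrite mulr_gt0 // ltr_wpDl.
have dE : (k + 1) * (a + 1) = k + (k * a + a + 1) by ring.
have e_le1 : a / ((k + 1) * (a + 1)) <= 1.
  rewrite ler_pdivrMr // mul1r.
  have -> : (k + 1) * (a + 1) = a + (k * a + k + 1) by ring.
  by rewrite lerDl !addr_ge0 ?mulr_ge0.
have /le_lt_trans/(_ (_ : k * (a / ((k + 1) * (a + 1))) < a)) :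
    a <= k * (a / ((k + 1) * (a + 1))) by rewrite small ?divr_gt0.
rewrite ltxx; apply; rewrite mulrA ltr_pdivrMr // [a * _]mulrC ltr_pM2r //.
by rewrite dE ltrDl ltr_wpDl // addr_ge0 ?mulr_ge0.
Qed.

(** A family that is bounded below for the order of [R[i]] has a constant
    imaginary part, so the infimum can be taken on the real parts. *)
Lemma complex_inf (R : realType) (X : Type) (x0 : X) (J : X -> R[i])
    (b : R[i]) :
  (forall x, b <= J x) ->
  exists d, (forall x, d <= J x) /\ (forall e, 0 < e -> exists x, J x < d + e).
Proof.
move=> b_le.
have ImJ x : complex.Im (J x) = complex.Im b.
  by have := b_le x; rewrite lecE => /andP[/eqP].
pose E := range (fun x => complex.Re (J x)).
have infE : has_inf E.
  split; first by exists (complex.Re (J x0)), x0.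
  exists (complex.Re b) => _ [x _ <-].
  by have := b_le x; rewrite lecE => /andP[].
exists (Complex (inf E) (complex.Im b)); split=> [x|e].
  rewrite lecE /= ImJ eqxx /=; apply: ge_inf; first by case: infE.
  by exists x.
rewrite ltcE /= => /andP[/eqP Im_e Re_e].
have [_ [x _ <-] ltx] := inf_adherent Re_e infE.
exists x; rewrite ltcE raddfD /= ImJ Im_e addr0 eqxx /=.
by rewrite raddfD.
Qed.

(** * Positive forms *)

Section Hilbert.
Variables (R : realType) (H : hilbertType R).
Implicit Types x y z : H.
Local Notation C := R[i].
Lemma innerC x y : inner x y = (inner y x)^*.
Proof. by rewrite hermC expr0 mul1r. Qed.
Lemma innerDl x y z : inner (x + y) z = inner x z + inner y z.
Proof. exact: linearDl. Qed.
Lemma innerDr x y z : inner x (y + z) = inner x y + inner x z.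
Proof. exact: linearDr. Qed.
Lemma innerBl x y z : inner (x - y) z = inner x z - inner y z.
Proof. exact: linearBl. Qed.
Lemma innerBr x y z : inner x (y - z) = inner x y - inner x z.
Proof. exact: linearBr. Qed.
Lemma innerZl (a : C) x y : inner (a *: x) y = a * inner x y.
Proof. exact: linearZl_LR. Qed.
Lemma innerZr (a : C) x y : inner x (a *: y) = a^* * inner x y.
Proof. exact: linearZr_LR. Qed.
Lemma inner_suml I (r : seq I) (P : pred I) (E : I -> H) y :
  inner (\sum_(i <- r | P i) E i) y = \sum_(i <- r | P i) inner (E i) y.
Proof. exact: linear_sumlz. Qed.
Lemma inner0l y : inner 0 y = 0 :> C.
Proof. exact: linear0l. Qed.
Lemma inner0r y : inner y 0 = 0 :> C.
Proof. exact: linear0r. Qed.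

(** Cauchy-Schwarz: expand the squared norm of [|y|^2 x - <x, y> y], the
    component of [x] orthogonal to [y] scaled by [|y|^2]. *)
Lemma norm_inner_le x y : `|inner x y| <= `|x| * `|y|.
Proof.
have [->|y_neq0] := eqVneq y 0; first by rewrite inner0r normr0 mulr_ge0.
have y2_gt0 : 0 < `|y| ^+ 2 by rewrite exprn_gt0 // normr_gt0.
rewrite -[_ <= _](@ler_pXn2r C 2) ?nnegrE ?mulr_ge0 // exprMn normCK.
have : 0 <= inner (`|y| ^+ 2 *: x - inner x y *: y)
                  (`|y| ^+ 2 *: x - inner x y *: y).
  by rewrite inner_norm exprn_ge0.
rewrite !(innerBl, innerBr, innerZl, innerZr) !inner_norm [inner y x]innerC.
rewrite rmorphXn /= (CrealP (normr_real y)).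
set a := inner x y; set p := `|x|; set q := `|y|.
have -> : q ^+ 2 * (q ^+ 2 * p ^+ 2) - q ^+ 2 * (a^* * a) -
   (a * (q ^+ 2 * a^*) - a * (a^* * q ^+ 2)) =
   q ^+ 2 * (p ^+ 2 * q ^+ 2 - a * a^*) by ring.
by rewrite pmulr_rge0 // subr_ge0.
Qed.

(** If [<A x, x> = 0], the nonnegative function [c |-> <A (x + c y), x + c y>]
    has no constant term, hence its first-order term vanishes in every
    direction [c]. The directions [1] and ['i] together give [<A x, y> = 0],
    which is used for [y = A x]. *)
Lemma positive_op_null (A : {linear H -> H}) x :
  positive_op A -> inner (A x) x = 0 -> A x = 0.
Proof.
move=> A_ge0 Ax0; set y := A x; set q := inner (A y) y.
have q_ge0 : 0 <= q by exact: A_ge0.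
have form_ge0 (c : C) : 0 <= c^* * inner y y + c * inner (A y) x + c * c^* * q.
  have := A_ge0 (x + c *: y).
  rewrite (linearD A) (linearZ_LR A) /= !(innerDl, innerDr, innerZl, innerZr).
  rewrite Ax0 add0r.
  congr (0 <= _); rewrite -/y -/q; ring.
have cross (u : C) : u * u^* = 1 -> u^* * inner y y + u * inner (A y) x = 0.
  move=> u1; set w := u^* * _ + _.
  (* Compare the form at [c = e * u] and at [c = - e * u], and divide by [e]. *)
  have w_ge (s e : C) : s ^+ 2 = 1 -> s \is Num.real -> 0 < e ->
      0 <= s * w + e * q.
    move=> s1 s_real e_gt0; have /CrealP sC := s_real.
    have /CrealP eC := gtr0_real e_gt0.
    have := form_ge0 (e * (s * u)).
    rewrite !rmorphM /= eC sC.
    have -> : e * (s * u^*) * inner y y + e * (s * u) * inner (A y) x +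
      e * (s * u) * (e * (s * u^*)) * q =
      e * (s * w + e * (s ^+ 2 * (u * u^*)) * q).
      by rewrite /w; ring.
    by rewrite s1 u1 !mulr1 pmulr_rge0.
  have w_real : w \is Num.real.
    have := w_ge 1 1 (expr1n _ _) (rpred1 _) ltr01; rewrite !mul1r => /ger0_real.
    by rewrite rpredDr // ger0_real.
  apply/eqP; rewrite -normr_eq0; apply/eqP.
  apply: (@eq0_of_le_small _ _ q) => // e e_gt0 _.
  rewrite [q * e]mulrC real_ler_norml //; apply/andP; split; rewrite -subr_ge0.
    by rewrite opprK -[w]mul1r w_ge ?expr1n ?rpred1.
  by rewrite addrC -mulN1r w_ge ?sqrrN ?expr1n ?rpredN ?rpred1.
have h1 := cross 1; rewrite rmorph1 !mul1r in h1.
have hi := cross 'i; rewrite conjCi mulrN -expr2 sqrCi opprK in hi.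
have {}h1 := h1 erefl; have {}hi := hi erefl.
have : inner y y *+ 2 = 0.
  have -> : inner y y *+ 2 = (inner y y + inner (A y) x)
     + 'i * (- 'i * inner y y + 'i * inner (A y) x)
     + (- 1 - 'i ^+ 2) * (inner (A y) x - inner y y) by ring.
  by rewrite h1 hi sqrCi mulr0 opprK addNr mul0r !addr0.
by move/eqP; rewrite mulrn_eq0 /= inner_norm sqrf_eq0 normr_eq0 => /eqP.
Qed.

(** * The Riesz representation theorem and adjoints *)

Section Riesz.
Variables (f : H -> C) (M : C).
Hypotheses (f_lin : scalar f) (M_ge0 : 0 <= M).
Hypothesis f_le : forall x, `|f x| <= M * `|x|.

(** If [z] represents [f], then [energy x = |x - z|^2 - |z|^2]: the representing
    vector is the minimiser. *)
Definition energy x : C := inner x x - (f x + (f x)^*).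

Let fD x y : f (x + y) = f x + f y.
Proof. by have := f_lin 1 x y; rewrite scale1r mul1r. Qed.
Let f0 : f 0 = 0.
Proof. by apply/eqP; rewrite -(inj_eq (addrI (f 0))) -fD !addr0. Qed.
Let fZ (a : C) x : f (a *: x) = a * f x.
Proof. by have := f_lin a x 0; rewrite f0 !addr0. Qed.

Lemma energy_ge x : - M ^+ 2 <= energy x.
Proof.
rewrite /energy inner_norm lerBrDr.
have re : f x + (f x)^* \is Num.real.
  by apply/CrealP; rewrite rmorphD /= conjCK addrC.
have le2 : f x + (f x)^* <= 2 * (M * `|x|).
  apply: le_trans (real_ler_norm re) _; apply: le_trans (ler_normD _ _) _.
  by rewrite norm_conjC -mulr2n -[leLHS]mulr_natl ler_pM2l.
apply: le_trans (lerD (lexx _) le2) _.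
have : 0 <= (`|x| - M) ^+ 2 by rewrite real_exprn_even_ge0 // rpredB ?ger0_real.
by rewrite -[(_ <= `|x| ^+ 2)]subr_ge0; congr (0 <= _); ring.
Qed.

(** The parallelogram law makes [energy] uniformly convex: two near-minimisers
    are close to each other, as their midpoint cannot do better than the
    infimum. *)
Lemma energy_parallelogram x y :
  `|x - y| ^+ 2 = 2 * (energy x + energy y) - 4 * energy (2^-1 *: (x + y)).
Proof.
rewrite -!inner_norm /energy !(innerBl, innerBr) !(innerZl, innerZr).
rewrite !(innerDl, innerDr) fZ fD !rmorphM !rmorphD /= fmorphV /= conjC_nat.
by field.
Qed.

Lemma energyD x y :
  energy (y + x) =
    energy y + `|x| ^+ 2 + ((inner x y - f x) + (inner x y - f x)^*).
Proof.
rewrite /energy !(innerDl, innerDr) fD !(rmorphD, rmorphB) /=.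
rewrite -inner_norm -innerC.
by ring.
Qed.

(** The sublevel sets of [energy] just above its infimum [d] generate a Cauchy
    filter. At a point [y] of a small sublevel set, a step along [x] cannot lower
    the energy by more than [e], so [inner x y] is close to [f x]; this passes to
    the limit of the filter by Cauchy-Schwarz. *)
Lemma riesz_representation : exists z, forall x, f x = inner x z.
Proof.
have [d [d_le d_inf]] := complex_inf 0 energy_ge.
pose F := filter_from [set e : C | 0 < e] (fun e => [set x | energy x < d + e]).
have F_filter : Filter F.
  apply: filter_from_filter; first by exists 1 => /=.
  (* The harmonic sum replaces the minimum, as the order is partial. *)
  move=> e1 e2 /= e1_gt0 e2_gt0; exists (e1 * e2 / (e1 + e2)).
    by rewrite /= divr_gt0 ?mulr_gt0 ?addr_gt0.
  move=> x /= ltx; split; apply: lt_le_trans ltx _; rewrite lerD2l.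
    by rewrite ler_pdivrMr ?addr_gt0 // mulrDr lerDr mulr_ge0 ?ltW.
  by rewrite ler_pdivrMr ?addr_gt0 // mulrDr [e1 * e2]mulrC lerDl mulr_ge0 ?ltW.
have F_proper : ProperFilter F.
  by apply: filter_from_proper => // e /= /d_inf [x]; exists x.
have F_cauchy : cauchy F.
  apply: (@cauchy_exP C H) => e e_gt0.
  have e4_gt0 : 0 < e ^+ 2 / 4 by rewrite divr_gt0 ?exprn_gt0.
  have [x x_lt] := d_inf _ e4_gt0.
  exists x, (e ^+ 2 / 4) => // y /= y_lt.
  rewrite -ball_normE /ball_ /=.
  rewrite -[_ < _](@ltr_pXn2r C 2) ?nnegrE ?normr_ge0 ?ltW //.
  rewrite energy_parallelogram.
  have lt2 : 2 * (energy x + energy y) <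
             2 * (d + e ^+ 2 / 4 + (d + e ^+ 2 / 4)).
    by rewrite ltr_pM2l // ltrD.
  have le4 : - (4 * energy (2^-1 *: (x + y))) <= - (4 * d).
    by rewrite lerN2 ler_pM2l.
  by have := ltr_leD lt2 le4; congr (_ < _); field.
have /cauchy_cvgP/cvg_ex [z F_z] := F_cauchy.
exists z => x; apply/esym/eqP; rewrite -subr_eq0 -normr_eq0 -[_ == 0]sqrf_eq0.
apply/eqP; set w := _ - _; set k := `|x| ^+ 2 + 1.
have k_gt0 : 0 < k by rewrite ltr_wpDl ?exprn_ge0.
apply: (@eq0_of_le_small _ _ (4 * k)); first exact: exprn_ge0.
  by rewrite mulr_ge0 // ltW.
move=> e e_gt0 e_le1.
have [y [y_lt zy_lt]] : exists y, energy y < d + e /\ `|z - y| < e.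
  have : F ([set y | energy y < d + e] `&` ball z e).
    apply: filterI; first by exists e.
    by apply: F_z; exact: nbhsx_ballx.
  by rewrite -ball_normE => /filter_ex [y [? ?]]; exists y.
set v := inner x y - f x.
have v_le : `|v| ^+ 2 <= k * e.
  (* The step [- v^* ] is the direction of steepest descent of the energy along
     the line spanned by [x]; the factor [k^-1] keeps the quadratic term below
     half of the linear one. *)
  have := d_le (y + (- k^-1 * v^* ) *: x).
  rewrite energyD innerZl fZ -mulrBr -/v => /le_lt_trans.
  move=> /(_ (d + e + `|(- k^-1 * v^* ) *: x| ^+ 2 +
              (- k^-1 * v^* * v + (- k^-1 * v^* * v)^* ))).
  rewrite !ltrD2r => /(_ y_lt).
  rewrite normrZ !normrM normrN norm_conjC [`|k^-1|]gtr0_norm ?invr_gt0 //.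
  rewrite !rmorphM rmorphN /= conjCK fmorphV /= (CrealP (gtr0_real k_gt0)).
  rewrite -!addrA ltrDl -(pmulr_rgt0 _ k_gt0) => pos.
  rewrite -subr_ge0; apply: le_trans (ltW pos) _; rewrite -subr_ge0.
  have -> : k * e - `|v| ^+ 2 - k * (e + ((k^-1 * `|v| * `|x|) ^+ 2 +
      (- k^-1 * v^* * v + - k^-1 * v * v^* ))) = k^-1 * `|v| ^+ 2.
    have -> : `|v| ^+ 2 = v * v^* by rewrite normCK.
    rewrite !exprMn normCK.
    have -> : `|x| ^+ 2 = k - 1 by rewrite addrK.
    by field; rewrite gt_eqF.
  by rewrite mulr_ge0 ?exprn_ge0 ?invr_ge0 ?(ltW k_gt0).
have -> : w = v + inner x (z - y) by rewrite /w /v innerBr; ring.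
have u_le : `|inner x (z - y)| ^+ 2 <= k * e.
  apply: (@le_trans _ _ ((`|x| * `|z - y|) ^+ 2)).
    by rewrite ler_pXn2r ?nnegrE ?mulr_ge0 ?norm_inner_le.
  rewrite exprMn ler_pM ?exprn_ge0 ?lerDl //.
  by rewrite expr2 -[e]mulr1 ler_pM // ?(le_trans (ltW zy_lt)) // ltW.
set a := `|v| in v_le *; set b := `|inner x (z - y)| in u_le *.
apply: (@le_trans _ _ ((a + b) ^+ 2)).
  by rewrite ler_pXn2r ?nnegrE ?addr_ge0 /a /b ?normr_ge0 ?ler_normD.
have : 0 <= (a - b) ^+ 2.
  by rewrite real_exprn_even_ge0 // rpredB // ger0_real // normr_ge0.
move=> ab_ge0; rewrite -subr_ge0.
have -> : 4 * k * e - (a + b) ^+ 2 =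
    2 * (k * e + k * e - (a ^+ 2 + b ^+ 2)) + (a - b) ^+ 2 by ring.
by rewrite addr_ge0 // mulr_ge0 // subr_ge0 lerD.
Qed.

End Riesz.

(** [T] is bounded, so [riesz_representation] applies to [x |-> inner (T x) y] and
    the set from which [adjoint T y] is chosen is nonempty. *)
Lemma adjointP (T : {linear H -> H}) : bounded_op T ->
  forall x y, inner (T x) y = inner x (adjoint T y).
Proof.
move=> [M T_le] x y.
have M'_ge0 : 0 <= `|M| * `|y| by rewrite mulr_ge0.
have [] := @riesz_representation (fun x => inner (T x) y) _ _ M'_ge0.
- by move=> a u v /=; rewrite linearP innerDl innerZl.
- move=> u; apply: le_trans (norm_inner_le _ _) _.
  rewrite -mulrA [`|y| * _]mulrC mulrA ler_wpM2r //.
  apply: le_trans (T_le u) _; have Mu_ge0 := le_trans (normr_ge0 _) (T_le u).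
  by rewrite -[leLHS](ger0_norm Mu_ge0) normrM normr_id.
move=> z Tz; move: x.
apply: (@xgetPex H 0 [set z | forall x, inner (T x) y = inner x z]).
by exists z.
Qed.

Lemma inner_iter_adjoint (T : {linear H -> H}) : bounded_op T ->
  forall k x y, inner (iter k (adjoint T) x) y = inner x (iter k T y).
Proof.
move=> T_bounded; elim=> // k IHk x y.
by rewrite iterS innerC -adjointP // -innerC IHk -iterSr.
Qed.

(** * Eigenvectors of an isosymmetric operator *)

Lemma iter_eigenvector (T : {linear H -> H}) (a : C) x k :
  T x = a *: x -> iter k T x = a ^+ k *: x.
Proof.
move=> Tx; elim: k => [|k IHk]; first by rewrite scale1r.
by rewrite iterS IHk linearZ_LR Tx scalerA -exprSr.
Qed.

(** The binomial sum is that of [(b^* - a) ^+ n]: each [T] acts on [x] as [a], and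
    each adjoint is moved to [y], where it becomes [b^*]. *)
Lemma inner_symm_op (A T : {linear H -> H}) n (a b : C) x y : bounded_op T ->
  T x = a *: x -> T y = b *: y ->
  inner (symm_op A T n x) y = (b^* - a) ^+ n * inner (A x) y.
Proof.
move=> T_bounded Tx Ty; rewrite inner_suml addrC exprDn mulr_suml.
apply: eq_bigr => k _; rewrite innerZl inner_iter_adjoint //.
rewrite (iter_eigenvector _ Tx) (iter_eigenvector _ Ty).
rewrite (linearZ_LR A) /= innerZl innerZr.
rewrite rmorphXn /= [(- a) ^+ _]exprNn -mulr_natr; ring.
Qed.

(** The vectors [iter j T x] are still eigenvectors for [a], so [inner_symm_op]
    applies to each term; what remains is the binomial sum of
    [(a * b^* - 1) ^+ m]. *)
Lemma inner_isosymm_op (A T : {linear H -> H}) m n (a b : C) x y :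
  bounded_op T -> T x = a *: x -> T y = b *: y ->
  inner (isosymm_op A T m n x) y =
    (a * b^* - 1) ^+ m * ((b^* - a) ^+ n * inner (A x) y).
Proof.
move=> T_bounded Tx Ty; rewrite inner_suml addrC exprDn mulr_suml.
apply: eq_bigr => j _; rewrite innerZl inner_iter_adjoint //.
have Tjx : T (iter j T x) = a *: iter j T x.
  by rewrite (iter_eigenvector _ Tx) linearZ_LR Tx !scalerA mulrC.
rewrite (iter_eigenvector _ Ty) innerZr (inner_symm_op _ _ _ Tjx Ty) //.
rewrite (iter_eigenvector _ Tx) linearZ_LR /= innerZl.
rewrite rmorphXn /= exprMn -mulr_natr; ring.
Qed.

Lemma eigenvector_eq0 (A T : {linear H -> H}) m n (a : C) x :
  positive_op A -> ~ point_spectrum A 0 -> bounded_op T ->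
  isosymmetric A m n T -> a^* != a -> `|a| != 1 -> T x = a *: x -> x = 0.
Proof.
move=> A_ge0 A_sp T_bounded T_iso a_nreal a_nunit Tx.
have := inner_isosymm_op A m n T_bounded Tx Tx.
rewrite T_iso inner0l => /esym/eqP.
rewrite !mulf_eq0 !expf_eq0 !subr_eq0 (negbTE a_nreal) -normCK sqrp_eq1 //.
rewrite (negbTE a_nunit) !andbF /= => /eqP /(positive_op_null A_ge0) Ax0.
apply/eqP; apply: contraT => x_neq0; case: A_sp.
by exists x; rewrite // scale0r.
Qed.

End Hilbert.

(** * The single valued extension property *)

(** First leave the real line by an imaginary step; if the result [c] has modulus
    1, stretching it by [1 + e / 4] leaves the circle without making it real. *)
Lemma nonreal_nonunit_near (R : realType) (a e : R[i]) : 0 < e ->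
  exists b, [/\ `|b - a| < e, b^* != b & `|b| != 1].
Proof.
move=> e_gt0.
have e4_gt0 : 0 < e / 4 by rewrite divr_gt0.
have e4C : (e / 4)^* = e / 4 by apply/CrealP; rewrite gtr0_real.
have [c c_near c_nreal] : exists2 c, `|c - a| <= e / 4 & c^* != c.
  have [a_real|] := eqVneq a^* a; last by exists a; rewrite // subrr normr0 ltW.
  exists (a + 'i * (e / 4)).
    by rewrite addrC addKr normrM normCi mul1r gtr0_norm.
  rewrite rmorphD rmorphM /= a_real conjCi e4C (inj_eq (addrI a)) mulNr.
  rewrite -subr_eq0 -opprD oppr_eq0 -mulr2n mulrn_eq0 mulf_eq0.
  by rewrite (negbTE (neq0Ci _)) (gt_eqF e4_gt0).
have [c_unit|] := eqVneq `|c| 1; last first.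
  move=> c_nunit; exists c; split=> //; apply: le_lt_trans c_near _.
  by rewrite ltr_pdivrMr // ltr_pMr // ltr1n.
have f_gt0 : 0 < 1 + e / 4 by rewrite addr_gt0.
exists (c * (1 + e / 4)); split.
- rewrite mulrDr mulr1 addrAC; apply: le_lt_trans (ler_normD _ _) _.
  rewrite normrM c_unit mul1r (gtr0_norm e4_gt0).
  apply: le_lt_trans (lerD c_near (lexx _)) _.
  have -> : e / 4 + e / 4 = e / 2 by field.
  by rewrite ltr_pdivrMr // ltr_pMr // ltr1n.
- rewrite rmorphM rmorphD rmorph1 /= e4C.
  by rewrite (inj_eq (mulIf (lt0r_neq0 f_gt0))).
- by rewrite normrM c_unit mul1r gtr0_norm // -subr_eq0 addrC addKr gt_eqF.
Qed.

Theorem theorem2p20 (R : realType) (H : hilbertType R) (Hsep : separable H)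
    (m n : nat) (m_gt0 : (0 < m)%N) (n_gt0 : (0 < n)%N)
    (A : {linear H -> H}) (A_bounded : bounded_op A)
    (A_ge0 : positive_op A) (A_sp : ~ point_spectrum A 0)
    (T : {linear H -> H}) (T_bounded : bounded_op T)
    (T_iso : isosymmetric A m n T) :
  svep T.
Proof.
move=> lambda0 D D_open _ f f_analytic Tf a Da.
have f_cont : {for a, continuous f}.
  exact/differentiable_continuous/derivable1_diffP/f_analytic.
apply/eqP; apply: contraT => fa_neq0.
have D_near : \forall b \near a, D b by exact: open_nbhs_nbhs.
have fb_near : \forall b \near a, f b != 0.
  exact: (@cvgr_neq0 _ _ _ _ _ f _ (f_cont)).
have /nbhs_normP [e /= e_gt0 e_near] : \forall b \near a, D b /\ f b != 0.
  exact: filterI.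
have [b [b_near b_nreal b_nunit]] := @nonreal_nonunit_near R a e e_gt0.
have [Db /eqP []] : D b /\ f b != 0 by apply: e_near; rewrite /= distrC.
apply: (eigenvector_eq0 A_ge0 A_sp T_bounded T_iso b_nreal b_nunit).
by apply/eqP; rewrite -subr_eq0; apply/eqP/Tf.
Qed.
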